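(* Let $n\ge 1$ and let $X$ be a simplicial complex that is $n$-cup-essential over $\mathbb{Z}$ or over $\mathbb{Z}_2$. Then the number of vertices of $X$ is at least \[ \sum_{k=0}^n \breve b_k\left(\left\lfloor\frac{\operatorname{sys} X}{2} \right\rfloor-1\right), \] and this sum satisfies \[ \sum_{k=0}^n \breve b_k\left(\left\lfloor\frac{\operatorname{sys} X}{2} \right\rfloor-1\right)\ \ge\ 2^n \binom{\left\lfloor\frac{\operatorname{sys} X}{2} \right\rfloor-1}{n}. \]
   Context: $\mathbb{Z}_2$ denotes the ring of residues modulo $2$. A simplicial complex $X$ is $n$-cup-essential over $R$ ($R=\mathbb{Z}$ or $\mathbb{Z}_2$) if there are $n$ (not necessarily distinct) classes in $H^1(X;R)$ whose cup-product is non-zero. The (edge-path) systole $\operatorname{sys} X$ is the smallest integer such that every closed path along the edges of $X$ of edge-length less than $\operatorname{sys} X$ is null-homotopic in $X$. (For $n\ge1$ an $n$-cup-essential complex has non-contractible loops, so its systole is finite.) The positive integers $\breve b_k(i)$, $k\ge 0$, $i\ge 0$, are defined by $\breve b_0(i)=1$, $\breve b_1(i)=2i+1$, and $\breve b_k(i)=\breve b_{k-1}(i)+2\sum_{0\le j\le i-1}\breve b_{k-1}(j)$ for $k\ge 2$. Equivalently, $\sum_{k,i\ge0}\breve b_k(i)u^kv^i=\frac{1}{1-v-u-uv}$. *)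

(* Defs.v *)
From HB Require Import structures.
From mathcomp Require Import all_boot all_order all_algebra finmap.
From mathcomp Require Import all_classical all_reals all_analysis.

Set Implicit Arguments.
Unset Strict Implicit.
Unset Printing Implicit Defensive.

Import Order.TTheory GRing.Theory Num.Theory.
Import numFieldNormedType.Exports.

Local Open Scope classical_set_scope.
Local Open Scope ring_scope.

(* Complexes may be infinite, and elements of V need not all be vertices. *)
Record simplicial_complex (V : choiceType) := SimplicialComplex {
  simplices :> {fset V} -> Prop ;
  simplices_neq0 : forall s, simplices s -> s != fset0 ;
  simplices_sub : forall s t : {fset V},
    simplices s -> (t `<=` s)%fset -> t != fset0 -> simplices t }.

Definition vertices (V : choiceType) (X : simplicial_complex V) : set V :=
  [set v | X [fset v]%fset].

(* Simplicial cohomology is computed by the ordered cochain complex: a cochain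
   of degree k is a function of the ordered k-simplices (v_0, ..., v_k), that
   is, of the sequences of length k.+1, possibly with repetitions, whose
   elements span a simplex. It is represented by a function on all sequences,
   of which only the values on ordered k-simplices are ever used. *)
Section Cohomology.
Context (V : choiceType) (A : comNzRingType).

Definition ordered_simplex (X : simplicial_complex V) (k : nat) (s : seq V) :=
  size s = k.+1 /\ X [fset v in s]%fset.

Definition cochain := seq V -> A.

Definition coboundary (f : cochain) : cochain :=
  fun s => \sum_(i < size s) (-1) ^+ i * f (take i s ++ drop i.+1 s).

Definition cocycle (X : simplicial_complex V) (k : nat) (f : cochain) :=
  forall s, ordered_simplex X k.+1 s -> coboundary f s = 0.

Definition is_coboundary (X : simplicial_complex V) (k : nat) (f : cochain) :=
  match k with
  | 0 => forall s, ordered_simplex X 0 s -> f s = 0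
  | _.+1 => exists g : cochain,
      forall s, ordered_simplex X k s -> f s = coboundary g s
  end.

(* The Alexander-Whitney product of f, of degree p, and g, of any degree. *)
Definition cup (p : nat) (f g : cochain) : cochain :=
  fun s => f (take p.+1 s) * g (drop p s).

Definition cup_seq1 (fs : seq cochain) : cochain :=
  foldr (cup 1) (fun _ => 1) fs.

(* Classes of H^1 are given by representing cocycles; the cup product of the
   classes is the class of the cup product of the representatives. *)
Definition cup_essential (X : simplicial_complex V) (n : nat) :=
  exists fs : n.-tuple cochain,
    (forall i, cocycle X 1 (tnth fs i)) /\ ~ is_coboundary X n (cup_seq1 fs).

End Cohomology.

Arguments cup_essential {V} A X n.

(* Points are given by their barycentric coordinates. *)
Section Realization.
Context (R : realType) (V : choiceType).

Definition geometric_simplex (s : {fset V}) : set (V -> R) :=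
  [set x | [/\ forall v, 0 <= x v, forall v, v \notin s -> x v = 0
             & \sum_(v <- s) x v = 1]].

Definition realization (X : simplicial_complex V) : Type :=
  set_type (\bigcup_(s in simplices X) geometric_simplex s).

Definition coords (X : simplicial_complex V) (x : realization X) : V -> R :=
  val x.

Context (X : simplicial_complex V).

HB.instance Definition _ := Choice.on (realization X).

(* The weak topology: U is open iff its trace on every closed simplex is open
   in that simplex, which has its Euclidean topology. *)
Definition realization_open : set_system (realization X) :=
  [set U | forall s, X s ->
    exists O : set (prod_topology (fun _ : V => R)), open O /\
      forall x : realization X, geometric_simplex s (coords x) ->
        (U x <-> O (coords x))].

Let realization_openT : realization_open setT.
Proof. by move=> s _; exists setT; split => //; exact: openT. Qed.

Let realization_openI : setI_closed realization_open.
Proof.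
move=> U W oU oW s Xs.
have [U' [oU' UU']] := oU s Xs; have [W' [oW' WW']] := oW s Xs.
exists (U' `&` W'); split; first exact: openI.
move=> x sx; have [Ul Ur] := UU' x sx; have [Wl Wr] := WW' x sx.
by split=> -[? ?]; split; auto.
Qed.

Let realization_open_bigU (I : Type) (f : I -> set (realization X)) :
  (forall i, realization_open (f i)) -> realization_open (\bigcup_i f i).
Proof.
move=> fo s Xs.
pose tr (i : I) (O : set (prod_topology (fun _ : V => R))) := open O /\
  forall x : realization X, geometric_simplex s (coords x) ->
    (f i x <-> O (coords x)).
have /boolp.choice [F FP] : forall i, exists O, tr i O.
  by move=> i; exact: (fo i).
exists (\bigcup_i F i); split.
  by apply: bigcup_open => i _; have [] := FP i.
by move=> x sx; split=> -[i _ fxi]; exists i => //;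
  have [_ fO] := FP i; exact/(fO x sx).
Qed.

HB.instance Definition _ := isOpenTopological.Build (realization X)
  realization_openT realization_openI realization_open_bigU.

End Realization.

Section Systole.
Context (R : realType) (V : choiceType) (X : simplicial_complex V).

Definition edge : rel V := fun u v => (u != v) && `[< X [fset u; v]%fset >].

(* The closed path v0, p_1, ..., p_m = v0, of edge-length m = size p. *)
Definition closed_edge_path (v0 : V) (p : seq V) : Prop :=
  [/\ vertices X v0, path edge v0 p & last v0 p = v0].

Definition vertex_point (v : V) : V -> R := fun w => (w == v)%:R.

(* The unit-speed parametrization, over [0, size p], of the path v0 :: p. *)
Definition edge_path_point (v0 : V) (p : seq V) (t : R) : V -> R := fun w =>
  let i := Num.truncn t in
  (1 - (t - i%:R)) * vertex_point (nth v0 (v0 :: p) i) w +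
  (t - i%:R) * vertex_point (nth v0 (v0 :: p) i.+1) w.

(* Homotopy to the constant loop, relative to the base point v0. *)
Definition null_homotopic (v0 : V) (p : seq V) : Prop :=
  exists H : R * R -> realization R X,
    [/\ {within `[0, 1] `*` `[0, (size p)%:R], continuous H},
        forall t, t \in `[0, (size p)%:R] ->
          coords (H (0, t)) = edge_path_point v0 p t,
        forall t, t \in `[0, (size p)%:R] ->
          coords (H (1, t)) = vertex_point v0
      & forall s, s \in `[0, 1] ->
          coords (H (s, 0)) = vertex_point v0 /\
          coords (H (s, (size p)%:R)) = vertex_point v0].

Definition short_loops_contractible (m : nat) : Prop :=
  forall v0 p, closed_edge_path v0 p -> (size p < m)%N -> null_homotopic v0 p.

(* The largest m such that all closed edge paths shorter than m are
   null-homotopic, i.e. the least length of one which is not. If all closed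
   edge paths are null-homotopic (infinite systole), the value 0 is junk. *)
Definition sys : nat :=
  xget 0%N [set m | short_loops_contractible m /\
    forall k, short_loops_contractible k -> (k <= m)%N].

End Systole.

Fixpoint breve_b (k i : nat) : nat :=
  match k with
  | 0 => 1
  | 1 => (2 * i + 1)%N
  | (_.+1 as k').+1 => (breve_b k' i + 2 * \sum_(j < i) breve_b k' j)%N
  end.

(* Main.v *)
Require Import Defs.
From mathcomp Require Import all_boot all_order all_algebra finmap.
From mathcomp Require Import zify ring.
From mathcomp Require Import all_classical all_reals all_analysis.

Set Implicit Arguments.
Unset Strict Implicit.
Unset Printing Implicit Defensive.

Import Order.TTheory GRing.Theory Num.Theory.
Import numFieldNormedType.Exports.

Local Open Scope classical_set_scope.
Local Open Scope card_scope.
Local Open Scope ring_scope.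

(** The number [breve_b k i] counts the lattice points of the ball of radius [i]
    for the l^1 metric on Z^k, and the theorem compares the vertices of [X] with
    these points. Write [i] for half the systole, rounded down, minus 1. What is
    used of the systole is that a cocycle of degree 1 has sum zero along every
    closed edge path of length at most [2 * i + 1]
    ([null_homotopic_walk_sum], [short_loops_null_sys]); hence it is a coboundary
    on every ball of radius [i] of the edge graph ([edge_ball_potential]).

    Let [f, f_2, .., f_n] be cocycles with a non-trivial product. A hypersurface
    dual to [f] carries a non-trivial product of [f_2, .., f_n]; choose it with
    as few vertices as possible. A ball of radius [i] centred on it is cut into
    two sides. Pushing the hypersurface inside the ball of radius [q] to the
    sphere of radius [q + 1] on one of the sides yields a dual hypersurface
    again, so by minimality that half-sphere has at least as many vertices as
    the hypersurface has in the ball of radius [q]. Summing over [q] and over the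
    sides gives the recursion [breve_bS] of the lattice balls, so by induction on
    [n] some ball of radius [i] has at least [breve_b n i] vertices. Since [f] is a
    coboundary on this ball, the Lusternik-Schnirelmann argument ([trivial_cup1])
    shows that [f_2, .., f_n] still have a non-trivial product on the complement,
    which therefore has at least the sum of the [breve_b k i] for [k < n]
    vertices. The two counts add up to the bound ([essential_ball_card]).

    The coefficients matter only in the construction of hypersurfaces. Modulo 2
    one takes a smallest vertex set off which [f] is a coboundary
    ([has_hypersurfaces_Z2]). Over the integers such a set may have more than two
    sides, and one takes instead the frontier of a region of the infinite cyclic
    cover defined by [f], with the fewest vertices ([has_hypersurfaces_int]);
    duality is then summation over the lifts of simplices
    ([trivial_cup1_cyclic_cover]).

    Cochains are functions on ordered simplices throughout, so that all the
    primitives of cup products are given by explicit formulas. *)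

(** * Ordered cochains *)

Section Cochains.
Context (V : choiceType) (A : comNzRingType).
Implicit Types (c h Phi f : cochain V A) (s t r : seq V) (x y z : V).

Lemma coboundary_nil c : coboundary c [::] = 0.
Proof. by rewrite /coboundary big_ord0. Qed.

(** Splitting off the deletion of the head lets coboundaries be computed by
    induction on the sequence, without handling signs and indices. *)
Lemma coboundary_cons c x s :
  coboundary c (x :: s) = c s - coboundary (fun t => c (x :: t)) s.
Proof.
rewrite /coboundary /= big_ord_recl /= expr0 mul1r drop0; congr (_ + _).
rewrite -sumrN; apply: eq_bigr => i _.
by rewrite /bump /= add1n exprS mulN1r mulNr.
Qed.

Lemma coboundary1 c x : coboundary c [:: x] = c [::].
Proof. by rewrite coboundary_cons coboundary_nil subr0. Qed.

Lemma coboundaryE2 c x y : coboundary c [:: x; y] = c [:: y] - c [:: x].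
Proof. by rewrite coboundary_cons coboundary1. Qed.

Lemma eq_coboundary c c' s :
  (forall t, size t = (size s).-1 -> {subset t <= s} -> c t = c' t) ->
  coboundary c s = coboundary c' s.
Proof.
move=> cc'; apply: eq_bigr => i _; congr (_ * _); apply: cc'.
  rewrite size_cat size_take size_drop ltn_ord.
  by have := ltn_ord i; lia.
by move=> x; rewrite mem_cat => /orP[/mem_take|/mem_drop].
Qed.

Lemma coboundaryD c c' s :
  coboundary (fun t => c t + c' t) s = coboundary c s + coboundary c' s.
Proof. by rewrite -big_split; apply: eq_bigr => i _; rewrite mulrDr. Qed.

Lemma coboundaryB c c' s :
  coboundary (fun t => c t - c' t) s = coboundary c s - coboundary c' s.
Proof. by rewrite -sumrB; apply: eq_bigr => i _; rewrite mulrBr. Qed.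

Lemma coboundaryZ (a : A) c s :
  coboundary (fun t => a * c t) s = a * coboundary c s.
Proof. by rewrite mulr_sumr; apply: eq_bigr => i _; rewrite mulrCA. Qed.

Lemma coboundary_sum (I : finType) (F : I -> cochain V A) s :
  coboundary (fun t => \sum_i F i t) s = \sum_i coboundary (F i) s.
Proof.
rewrite /coboundary exchange_big; apply: eq_bigr => i _.
by rewrite mulr_sumr.
Qed.

Lemma coboundary0 c s : (forall t, c t = 0) -> coboundary c s = 0.
Proof. by move=> c0; apply: big1 => i _; rewrite c0 mulr0. Qed.

Lemma coboundaryK c s : coboundary (coboundary c) s = 0.
Proof.
elim: s c => [|x s IH] c; first exact: coboundary_nil.
rewrite coboundary_cons.
under [X in _ - X]eq_coboundary => t _ _ do rewrite coboundary_cons.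
by rewrite coboundaryB IH subr0 subrr.
Qed.

Lemma coboundary_map (W : choiceType) (phi : W -> V) c (s : seq W) :
  coboundary c (map phi s) = coboundary (fun u : seq W => c (map phi u)) s.
Proof.
rewrite /coboundary size_map; apply: eq_bigr => i _.
by rewrite map_cat map_take map_drop.
Qed.

Lemma cup1E f Phi x y r :
  cup 1 f Phi (x :: y :: r) = f [:: x; y] * Phi (y :: r).
Proof. by rewrite /cup /= take0. Qed.

(** The Leibniz rule for a factor of degree 1 that is closed on the sequence at
    hand. With an empty tail the two sides are multiples of [h [::]] by
    unrelated values of [f], whence the second condition. *)
Lemma coboundary_cup1 f h x y r :
    (forall z, z \in r -> f [:: x; y] + f [:: y; z] = f [:: x; z]) ->
    (r = [::] -> h [::] = 0) ->
  coboundary (cup 1 f h) (x :: y :: r)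
    = - (f [:: x; y] * coboundary h (y :: r)).
Proof.
case: r => [|z r] fxyz h0.
  by rewrite coboundaryE2 coboundary1 /cup /= !h0 // !mulr0 subrr oppr0.
rewrite !coboundary_cons !cup1E.
under [X in _ - (_ - (_ - X))]eq_coboundary => t _ _ do rewrite cup1E.
rewrite coboundaryZ -(fxyz z (mem_head _ _)).
by ring.
Qed.

Lemma coboundary_mul_head (a : V -> A) Phi x y r :
    coboundary Phi (x :: y :: r) = 0 ->
  coboundary (fun t => if t is v :: _ then a v * Phi t else 0) (x :: y :: r)
    = (a y - a x) * Phi (y :: r).
Proof.
move=> dPhi; rewrite coboundary_cons coboundaryZ.
move: dPhi; rewrite coboundary_cons => /subr0_eq <-.
by rewrite -mulrBl.
Qed.

End Cochains.

(** A complex given by its ordered simplices, whose vertices are all the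
    elements of the type; the empty sequence is allowed as a simplex, so that
    passing to faces needs no side condition. *)
Record vcomplex (V : choiceType) := VComplex {
  vsimplex :> seq V -> Prop;
  vsimplexS : forall s t, {subset t <= s} -> vsimplex s -> vsimplex t;
  vsimplex1 : forall x, vsimplex [:: x] }.

Section CochainNotions.
Context (V : choiceType) (A : comNzRingType) (K : seq V -> Prop).
Implicit Types (f Phi : cochain V A) (x y z : V).

Definition cocycle1 f := forall x y z, K [:: x; y; z] ->
  f [:: x; y] + f [:: y; z] = f [:: x; z].

Definition closed_cochain p Phi := forall s, size s = p.+2 -> K s ->
  coboundary Phi s = 0.

(** The condition on the empty sequence makes this the vanishing of [Phi] in
    degree 0, where [coboundary h [:: x]] is [h [::]]. *)
Definition trivial_cochain p Phi := exists h : cochain V A,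
  h [::] = 0 /\ forall s, size s = p.+1 -> K s -> Phi s = coboundary h s.

Definition adj x y := `[< K [:: x; y] >].

Fixpoint walk_sum f x (p : seq V) : A :=
  if p is y :: q then f [:: x; y] + walk_sum f y q else 0.

(** Walks may pause at a vertex, adjacency being reflexive on vertices. *)
Definition short_loops_null f L := forall x p, path adj x p ->
  last x p = x -> (size p <= L)%N -> walk_sum f x p = 0.

End CochainNotions.

Section Complex.
Context (V : choiceType) (A : comNzRingType) (K : vcomplex V).
Implicit Types (c h Phi f : cochain V A) (s t r : seq V) (x y z : V).

Lemma adj_refl x : adj K x x.
Proof.
apply/asboolP; apply: vsimplexS (vsimplex1 K x) => y.
by rewrite !inE orbb.
Qed.

Lemma adjC x y : adj K x y = adj K y x.
Proof.
by apply/asboolP/asboolP; apply: vsimplexS => z; rewrite !inE orbC.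
Qed.

Lemma vsimplex_adj s x y : K s -> x \in s -> y \in s -> adj K x y.
Proof.
move=> Ks xs ys; apply/asboolP; apply: vsimplexS Ks => z.
by rewrite !inE => /orP[] /eqP ->.
Qed.

Lemma cocycle1_adj f s x y z : cocycle1 K f -> K s ->
  x \in s -> y \in s -> z \in s -> f [:: x; y] + f [:: y; z] = f [:: x; z].
Proof.
move=> cf Ks xs ys zs; apply: cf; apply: vsimplexS Ks => w.
by rewrite !inE => /or3P[] /eqP ->.
Qed.

Lemma cocycle1_diag f x : cocycle1 K f -> f [:: x; x] = 0.
Proof.
move=> cf; have := cocycle1_adj cf (vsimplex1 K x).
move=> /(_ x x x (mem_head _ _) (mem_head _ _) (mem_head _ _)).
by move=> /(canRL (addKr _)); rewrite addNr.
Qed.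

Lemma cocycle1_anti f x y : cocycle1 K f -> adj K x y ->
  f [:: y; x] = - f [:: x; y].
Proof.
move=> cf /asboolP Kxy; apply/eqP; rewrite -addr_eq0 addrC.
rewrite (cocycle1_adj cf Kxy) ?mem_head ?cocycle1_diag //.
by rewrite !inE eqxx orbT.
Qed.

Lemma closed_cup1 f p Phi : cocycle1 K f -> closed_cochain K p Phi ->
  closed_cochain K p.+1 (cup 1 f Phi).
Proof.
move=> cf cPhi [|x [|y [|z r]]] // [sz] Ks.
rewrite coboundary_cup1 // => [|w wr].
  rewrite cPhi ?mulr0 ?oppr0 //=; first by rewrite sz.
  by apply: vsimplexS Ks => w wr; rewrite inE wr orbT.
by apply: (cocycle1_adj cf Ks); rewrite !inE ?eqxx ?orbT // -in_cons wr !orbT.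
Qed.

Lemma closed_cup_seq1 (fs : seq (cochain V A)) :
    (forall f, f \in fs -> cocycle1 K f) ->
  closed_cochain K (size fs) (cup_seq1 fs).
Proof.
elim: fs => [|f fs IH] cfs /=.
  by move=> [|x [|y []]] // _ _; rewrite coboundaryE2 subrr.
apply: closed_cup1; first exact/cfs/mem_head.
by apply: IH => g gfs; apply: cfs; rewrite inE gfs orbT.
Qed.

(** The Lusternik-Schnirelmann argument: if [f] is a coboundary on the part of
    the vertices in [B] and [Phi] is one on the part off [B], their product is
    a coboundary. On a simplex that meets [B], [f] has a unique primitive
    [b] extending [g], and the product of [b] with [Phi - coboundary h] is a
    primitive of the product of [f] with [Phi - coboundary h]. Faces that miss
    [B] have no such [b], but there [Phi - coboundary h] vanishes. *)
Lemma trivial_cup1 f p Phi (B : pred V) (g : V -> A) h :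
    cocycle1 K f -> closed_cochain K p Phi ->
    (forall x y, B x -> B y -> adj K x y -> f [:: x; y] = g y - g x) ->
    h [::] = 0 ->
    (forall s, size s = p.+1 -> K s -> all (predC B) s ->
       Phi s = coboundary h s) ->
  trivial_cochain K p.+1 (cup 1 f Phi).
Proof.
move=> cf cPhi fg h0 Phih.
pose Phi' : cochain V A := fun s => Phi s - coboundary h s.
(* [b s] is transported from the first element of [s] that lies in [B]. *)
pose b s x : A := if seq.filter B s is w :: _ then g w + f [:: w; x] else 0.
pose c1 : cochain V A := fun s => if s is x :: _ then b s x * Phi' s else 0.
exists (fun s => c1 s - cup 1 f h s); split.
  by rewrite /c1 /cup /= h0 mulr0 subrr.
case=> [|x [|y r]] //= [sz] Ks; rewrite cup1E coboundaryB.
have ins : {subset y :: r <= x :: y :: r} by move=> z zr; rewrite inE zr orbT.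
have Kyr := vsimplexS ins Ks.
rewrite coboundary_cup1 //; last first.
  by move=> z zr; apply: (cocycle1_adj cf Ks); rewrite !inE ?eqxx ?zr ?orbT.
rewrite opprK; case: (boolP (has B (x :: y :: r))) => [hB|nB]; last first.
  rewrite -Phih //=; last first.
  - by move: nB; rewrite -all_predC => /andP[].
  - by rewrite sz.
  rewrite [X in X + _](_ : _ = 0) ?add0r //.
  rewrite -[RHS](@coboundary0 _ _ (fun=> 0) (x :: y :: r)) //.
  apply: eq_coboundary => t tsz tsub; case: t tsz tsub => [//|v t] tsz tsub.
  rewrite /c1 /b; suff -> : seq.filter B (v :: t) = [::] by rewrite mul0r.
  apply/eqP; rewrite -size_eq0 size_filter -leqn0 leqNgt -has_count.
  by apply: contra nB => /hasP[w /tsub ws Bw]; apply/hasP; exists w.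
have [w ws Bw] := hasP hB.
have bE t v : v \in t -> {subset t <= x :: y :: r} -> has B t ->
    b t v = g w + f [:: w; v].
  move=> vt tsub; rewrite has_filter /b.
  case E : (seq.filter B t) => [//|w' t'] _.
  have : w' \in seq.filter B t by rewrite E mem_head.
  rewrite mem_filter => /andP[Bw' /tsub w's].
  rewrite -(cocycle1_adj cf Ks ws w's (tsub _ vt)).
  rewrite (fg w w') ?(vsimplex_adj Ks) //.
  by ring.
have -> : coboundary c1 (x :: y :: r) = coboundary
    (fun t => if t is v :: _ then (g w + f [:: w; v]) * Phi' t else 0)
    (x :: y :: r).
  apply: eq_coboundary => t tsz tsub.
  case: t tsz tsub => [//|v t] tsz tsub.
  rewrite /c1; case: (boolP (has B (v :: t))) => [hB'|nB'].
    by rewrite bE ?mem_head.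
  have -> : Phi' (v :: t) = 0.
    apply/eqP; rewrite subr_eq0; apply/eqP/Phih => //.
      by rewrite tsz /= sz.
    - exact: vsimplexS Ks.
    - by rewrite all_predC.
  by rewrite !mulr0.
rewrite coboundary_mul_head; last first.
  by rewrite coboundaryB coboundaryK subr0 cPhi //= sz.
rewrite -(cocycle1_adj cf Ks ws (mem_head _ _) (ins _ (mem_head _ _))).
by rewrite /Phi'; ring.
Qed.

End Complex.

(** * Walks and balls in the edge graph *)

Section Walks.
Context (V : choiceType) (A : comNzRingType) (K : vcomplex V).
Context (f : cochain V A).
Implicit Types (p q : seq V) (x y z : V).

Lemma walk_sum_cat x p q :
  walk_sum f x (p ++ q) = walk_sum f x p + walk_sum f (last x p) q.
Proof. by elim: p x => [|y p IH] x /=; rewrite ?add0r // IH addrA. Qed.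

Lemma walk_sum_rcons x p y :
  walk_sum f x (rcons p y) = walk_sum f x p + f [:: last x p; y].
Proof. by rewrite -cats1 walk_sum_cat /= addr0. Qed.

Lemma last_rev_belast x p : last (last x p) (rev (belast x p)) = x.
Proof. by case: p => [//|y p] /=; rewrite rev_cons last_rcons. Qed.

Lemma path_rev x p : path (adj K) x p ->
  path (adj K) (last x p) (rev (belast x p)).
Proof.
rewrite rev_path; congr path; apply/funext => y; apply/funext => z /=.
exact: adjC.
Qed.

Lemma walk_sum_rev x p : cocycle1 K f -> path (adj K) x p ->
  walk_sum f (last x p) (rev (belast x p)) = - walk_sum f x p.
Proof.
move=> cf; elim: p x => [|y p IH] x /=; first by rewrite oppr0.
move=> /andP[xy yp]; rewrite rev_cons walk_sum_rcons IH // last_rev_belast.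
by rewrite (cocycle1_anti cf xy) opprD addrC.
Qed.

End Walks.

Section Balls.
Context (T : finType) (K : vcomplex T).
Implicit Types (x y z : T) (i j q : nat).

Fixpoint edge_ball x j : {set T} :=
  if j is k.+1 then [set y | [exists z in edge_ball x k, adj K z y]]
  else [set x].

Lemma edge_ball_adj x j y z : y \in edge_ball x j -> adj K y z ->
  z \in edge_ball x j.+1.
Proof. by move=> yj yz; rewrite inE; apply/exists_inP; exists y. Qed.

Lemma edge_ball_le x i j : (i <= j)%N -> edge_ball x i \subset edge_ball x j.
Proof.
elim: j => [|j IH]; first by rewrite leqn0 => /eqP ->.
rewrite leq_eqVlt => /orP[/eqP -> //|/IH /fintype.subsetP ij].
by apply/fintype.subsetP => y /ij yj; apply: edge_ball_adj yj (adj_refl K y).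
Qed.

Lemma edge_ball_center x j : x \in edge_ball x j.
Proof. by apply: (fintype.subsetP (edge_ball_le x (leq0n j))); rewrite inE. Qed.

Lemma edge_ball_walk x j y : y \in edge_ball x j ->
  exists p, [/\ path (adj K) x p, last x p = y & size p = j].
Proof.
elim: j y => [|j IH] y; first by rewrite inE => /eqP ->; exists [::].
rewrite inE => /exists_inP[z /IH[p [xp <- <-]] zy].
by exists (rcons p y); rewrite rcons_path xp zy last_rcons size_rcons.
Qed.

(** Integrate [f] along walks of length [i] from the centre. For an edge between
    [y] and [z], the walk to [y], the edge, and the walk to [z] run backwards
    form a closed walk of length [2 * i + 1], so the two values differ by the
    value of [f] on the edge. *)
Lemma edge_ball_potential (A : comNzRingType) (f : cochain T A) i x :
    cocycle1 K f -> short_loops_null K f (2 * i + 1) ->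
  exists g : T -> A, g x = 0 /\ forall y z,
    y \in edge_ball x i -> z \in edge_ball x i -> adj K y z ->
    f [:: y; z] = g z - g y.
Proof.
move=> cf nf.
have /choice[w wP] : forall y, exists p, y \in edge_ball x i ->
    [/\ path (adj K) x p, last x p = y & size p = i].
  move=> y; case: (boolP (y \in edge_ball x i)) => [/edge_ball_walk[p]|_].
    by exists p.
  by exists [::].
exists (fun y => walk_sum f x (w y)); split.
  have [xp lp sp] := wP x (edge_ball_center x i).
  by apply: (nf) => //; rewrite sp; lia.
move=> y z /wP[yp ly ys] /wP[zp lz zs] yz.
have := nf x (w y ++ z :: rev (belast x (w z))).
have rp : path (adj K) z (rev (belast x (w z))).
  by move: (path_rev zp); rewrite lz.
have rl : last z (rev (belast x (w z))) = x.
  by move: (last_rev_belast x (w z)); rewrite lz.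
have rs : walk_sum f z (rev (belast x (w z))) = - walk_sum f x (w z).
  by move: (walk_sum_rev cf zp); rewrite lz.
rewrite cat_path yp ly /= yz rp last_cat /= rl size_cat /= size_rev size_belast.
rewrite ys zs walk_sum_cat /= ly rs addrA => /(_ isT erefl).
move=> /(_ ltac:(lia))/subr0_eq <-.
by rewrite addrAC subrr add0r.
Qed.

(** A hypersurface, where [side] is [None], divides the balls around [x] into two
    sides. The spheres on a given side are disjoint, so bounding each of them
    from below by the hypersurface in the preceding ball bounds the side by a
    sum over the smaller radii. *)
Lemma card_edge_ball_sides x i (side : T -> option bool) :
    (forall q b, (q < i)%N ->
       (#|[set v in edge_ball x q | side v == None]| <=
        #|[set v in edge_ball x q.+1 :\: edge_ball x q
            | side v == Some b]|)%N) ->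
  forall j, (j <= i)%N ->
    (#|[set v in edge_ball x j | side v == None]| +
     2 * \sum_(l < j) #|[set v in edge_ball x l | side v == None]| <=
     #|edge_ball x j|)%N.
Proof.
move=> sides j ji.
pose D q (o : option bool) := [set v in edge_ball x q | side v == o].
have sideD b : (\sum_(l < j) #|D l None| <= #|D j (Some b)|)%N.
  elim: j ji => [|j IH] ji; first by rewrite big_ord0.
  rewrite big_ord_recr /=.
  apply: leq_trans (leq_add (IH (ltnW ji)) (sides j b ji)) _.
  rewrite -cardsUI [X in (_ + X)%N](_ : _ = 0)%N ?addn0; last first.
    by apply/eqP; rewrite cards_eq0; apply/eqP/setP => v; rewrite !inE;
      case: (v \in edge_ball x j); rewrite /= ?andbF.
  apply: subset_leq_card; apply/fintype.subsetP => v.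
  rewrite !inE => /orP[/andP[vj ->]|/andP[/andP[_ ->] ->]] //.
  by rewrite andbT; apply/exists_inP; exists v => //; exact: adj_refl.
have := leq_add (leqnn #|D j None|) (leq_add (sideD true) (sideD false)).
rewrite mul2n -addnn => /leq_trans; apply.
rewrite -(cardsID [set v | side v == None] (edge_ball x j)); apply: leq_add.
  by apply/subset_leq_card/fintype.subsetP => v; rewrite !inE.
rewrite -(cardsID [set v | side v == Some true] (_ :\: _)).
by apply: leq_add; apply/subset_leq_card/fintype.subsetP => v; rewrite !inE;
  case/andP=> -> /eqP ->.
Qed.

End Balls.

Section Pullback.
Context (V W : choiceType) (A : comNzRingType).
Context (K : seq V -> Prop) (L : seq W -> Prop) (phi : W -> V).
Hypothesis LK : forall s, L s -> K (map phi s).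

Definition pullback (f : cochain V A) : cochain W A :=
  fun s => f (map phi s).

Lemma pullback_cocycle1 f : cocycle1 K f -> cocycle1 L (pullback f).
Proof. by move=> cf x y z /LK; apply: cf. Qed.

Lemma pullback_short_loops_null f m :
  short_loops_null K f m -> short_loops_null L (pullback f) m.
Proof.
move=> nf x p xp lp sp.
have -> : walk_sum (pullback f) x p = walk_sum f (phi x) (map phi p).
  by elim: p x {xp lp sp} => //= y p IH x; rewrite IH.
apply: (nf); last by rewrite size_map.
  rewrite path_map; apply: sub_path xp => y z /asboolP yz.
  by apply/asboolP; exact: (LK yz).
by rewrite last_map lp.
Qed.

Lemma cup_seq1_pullback fs s :
  cup_seq1 (map pullback fs) s = cup_seq1 fs (map phi s).
Proof.
elim: fs s => //= f fs IH s.
by rewrite /cup /pullback IH map_take map_drop.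
Qed.

End Pullback.

Section Induced.
Context (V W : choiceType) (K : vcomplex V) (emb : W -> V).

Definition induced_vsimplex (s : seq W) := K (map emb s).

Lemma induced_vsimplexS s t :
  {subset t <= s} -> induced_vsimplex s -> induced_vsimplex t.
Proof.
move=> ts; apply: vsimplexS => x /mapP[y /ts ys ->].
by apply/mapP; exists y.
Qed.

Lemma induced_vsimplex1 x : induced_vsimplex [:: x].
Proof. exact: vsimplex1. Qed.

Definition induced_complex := VComplex induced_vsimplexS induced_vsimplex1.

End Induced.

Lemma trivial_induced (V W : choiceType) (A : comNzRingType)
    (K : seq V -> Prop) (L : seq W -> Prop) (emb : W -> V) (P : pred V)
    p (Phi : cochain V A) :
    (forall s, K (map emb s) -> L s) ->
    injective emb -> (forall x, P x -> exists w, emb w = x) ->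
    trivial_cochain L p (pullback emb Phi) ->
  exists h : cochain V A, h [::] = 0 /\ forall s, size s = p.+1 -> K s ->
    all P s -> Phi s = coboundary h s.
Proof.
move=> KL emb_inj embP [h [h0 hP]].
pose proj x := if pselect (exists w, emb w = x) is left e
  then Some (projT1 (cid e)) else None.
have projK : pcancel emb proj.
  move=> w; rewrite /proj; case: pselect => [e|[]]; last by exists w.
  by congr Some; apply: emb_inj; case: cid.
exists (fun s => h (pmap proj s)); split => // s sz Ks Ps.
have [s' es] : exists s', s = map emb s'.
  elim: s Ps {sz Ks} => [|x s IH] /=; first by exists [::].
  by case/andP=> /embP[w <-] /IH[s' ->]; exists (w :: s').
rewrite es coboundary_map -[LHS]/(pullback emb Phi s').
rewrite hP; first by apply: eq_coboundary => t _ _; rewrite map_pK.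
  by rewrite -sz es size_map.
by apply: KL; rewrite -es.
Qed.
Lemma edge_ball_induced (T W : finType) (K : vcomplex T) (emb : W -> T) x j y :
  y \in edge_ball (induced_complex K emb) x j ->
  emb y \in edge_ball K (emb x) j.
Proof.
elim: j y => [|j IH] y; first by rewrite !inE => /eqP ->.
rewrite inE => /exists_inP[z /IH zj /asboolP zy].
by apply: edge_ball_adj zj _; exact/asboolP.
Qed.


(** * Lattice points of cross-polytopes *)

(** This is the count of the lattice points of the ball of radius [i] for the
    l^1 metric on Z^(k+1), sliced by the last coordinate: the slice at height
    [h] is the ball of radius [i - |h|] in Z^k. *)
Lemma breve_bS k i :
  breve_b k.+1 i = (breve_b k i + 2 * \sum_(j < i) breve_b k j)%N.
Proof. by case: k => [|k] //=; rewrite sum1_card card_ord addnC. Qed.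

Lemma breve_b_ge k i : (2 ^ k * 'C(i, k) <= breve_b k i)%N.
Proof.
elim: k i => [|k IH] i; first by rewrite bin0.
have bin_sum : ('C(i, k.+1) = \sum_(j < i) 'C(j, k))%N.
  by elim: i => [|i IHi]; rewrite ?big_ord0 ?bin0n // big_ord_recr binS IHi.
rewrite breve_bS expnS -mulnA bin_sum big_distrr /=.
apply: leq_trans (leq_addl _ _); rewrite leq_pmul2l //.
exact: leq_sum.
Qed.



(** * Counting by hypersurfaces *)

(** A hypersurface dual to [f] is encoded as a finite complex [L] with a
    simplicial map [pi], which need not be injective. The second clause is the
    duality: multiplication by [f] factors through restriction to [L]. The third
    one is what minimality of the hypersurface gives: a ball centred on it
    contains a ball of the hypersurface and, on each of the two sides, as much
    as all its smaller balls together. *)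
Definition has_hypersurfaces (A : comNzRingType) := forall (T : finType)
    (K : vcomplex T) (i : nat) (f : cochain T A),
    cocycle1 K f -> short_loops_null K f (2 * i + 1) ->
  exists (Y : finType) (L : vcomplex Y) (pi : Y -> T),
    [/\ forall s, L s -> K (map pi s),
        forall p Phi, closed_cochain K p Phi ->
          trivial_cochain L p (fun s => Phi (map pi s)) ->
          trivial_cochain K p.+1 (cup 1 f Phi)
      & forall y j, (j <= i)%N ->
          (#|edge_ball L y j| + 2 * \sum_(l < j) #|edge_ball L y l| <=
           #|edge_ball K (pi y) j|)%N].

(** Both bounds go down to a complex on which the product of the cocycles after
    the first one is still non-trivial. For balls it is a hypersurface dual to
    the first cocycle. For the whole complex it is the complement of a large
    ball: the first cocycle is a coboundary on the ball, so by the
    Lusternik-Schnirelmann argument the others cannot have a trivial product off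
    the ball. *)
Lemma essential_ball_card (A : comNzRingType) (i n : nat) :
    has_hypersurfaces A ->
  forall (T : finType) (K : vcomplex T) (fs : seq (cochain T A)),
    size fs = n ->
    (forall f, f \in fs -> cocycle1 K f /\ short_loops_null K f (2 * i + 1)) ->
    ~ trivial_cochain K n (cup_seq1 fs) ->
  (exists x, forall j, (j <= i)%N -> (breve_b n j <= #|edge_ball K x j|)%N) /\
  (\sum_(0 <= k < n.+1) breve_b k i <= #|T|)%N.
Proof.
move=> hypA; elim: n => [|n IH] T K fs.
  move=> /size0nil -> _ ess.
  have [x _] : exists x : T, True.
    apply/not_existsP => T0; apply: ess; exists (fun=> 0); split => //.
    by case=> [|x s] // _ _; case: (T0 x).
  rewrite big_nat1; split; last by apply/card_gt0P; exists x.
  exists x => j _; apply/card_gt0P; exists x; exact: edge_ball_center.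
case: fs => [//|f fs] [sfs] cfs ess.
have [cf nf] := cfs f (mem_head _ _).
have {}cfs g : g \in fs -> cocycle1 K g /\ short_loops_null K g (2 * i + 1).
  by move=> gfs; apply: cfs; rewrite inE gfs orbT.
have closed_fs : closed_cochain K n (cup_seq1 fs).
  by rewrite -sfs; apply: closed_cup_seq1 => g /cfs[].
have IH' (W : finType) (L : vcomplex W) (phi : W -> T) :
    (forall s, L s -> K (map phi s)) ->
    ~ trivial_cochain L n (pullback phi (cup_seq1 fs)) ->
    (exists x, forall j, (j <= i)%N -> (breve_b n j <= #|edge_ball L x j|)%N) /\
    (\sum_(0 <= k < n.+1) breve_b k i <= #|W|)%N.
  move=> LK Less; apply: (IH W L (map (pullback phi) fs)).
  - by rewrite size_map.
  - move=> _ /mapP[g /cfs[cg ng] ->]; split.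
      exact: (pullback_cocycle1 LK cg).
    exact: (pullback_short_loops_null LK ng).
  - move=> [h [h0 hP]]; apply: Less; exists h; split => // s sz Ls.
    by rewrite -hP // cup_seq1_pullback.
have [Y [L [pi [LK Lf Lball]]]] := hypA T K i f cf nf.
have [|[y yP] _] := IH' Y L pi LK.
  by move=> triv; apply/ess/Lf.
have ballP j : (j <= i)%N -> (breve_b n.+1 j <= #|edge_ball K (pi y) j|)%N.
  move=> ji; rewrite breve_bS; apply: leq_trans (Lball y j ji).
  apply: leq_add; first exact: yP.
  rewrite leq_pmul2l //; apply: leq_sum => l _; apply: yP.
  by apply: leq_trans ji; apply: ltnW.
split; first by exists (pi y).
pose B := edge_ball K (pi y) i.
have [||_] := IH' {x | x \notin B} (induced_complex K val) val.
- by [].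
- move=> triv; have [|h [h0 hP]] :=
    trivial_induced (K := K) (P := [predC B]) (fun s => id) val_inj _ triv.
    by move=> v vB; exists (exist _ v vB).
  apply: ess.
  have [g [_ gP]] := edge_ball_potential (pi y) cf nf.
  exact: (trivial_cup1 (B := mem B) cf closed_fs gP h0).
rewrite card_sig => sumB.
rewrite big_nat_recr //= addnC -(cardC (mem B)).
by apply: leq_add; [exact: ballP|].
Qed.

(** * Hypersurfaces of cocycles modulo 2 *)

Lemma Z2_cases (a : 'Z_2) : a = 0 \/ a = 1.
Proof.
by case: a => [[|[|//]] lt_a]; [left|right]; apply/val_inj.
Qed.

(** The hypersurface is a smallest set [C] of vertices off which [f] is the
    coboundary of some [g]. On a ball, [f] also has a potential [c]; off [C] the
    difference [c - g] is locally constant, and its two possible values are the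
    two sides. Trading the vertices of [C] in the ball of radius [q] for the
    sphere of radius [q.+1] on one side yields a set off which [f] is still a
    coboundary, so this sphere is at least as large as the part traded. *)
Lemma has_hypersurfaces_Z2 : has_hypersurfaces 'Z_2.
Proof.
move=> T K i f cf nf.
pose cut (C : {set T}) := `[< exists g : T -> 'Z_2, forall u v,
  u \notin C -> v \notin C -> adj K u v -> f [:: u; v] = g v - g u >].
have cutT : cut (setTfor T).
  by apply/asboolP; exists (fun=> 0) => u v; rewrite inE.
have [C /asboolP[g gP] Cmin] := arg_minnP (fun C : {set T} => #|C|) cutT.
pose L := induced_complex K (val : {x | x \in C} -> T).
exists {x | x \in C}, L, val; split => //.
  move=> p Phi cPhi triv; have [|h [h0 hP]] :=
    trivial_induced (K := K) (P := mem C) (fun s => id) val_inj _ triv.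
    by move=> v vC; exists (exist _ v vC).
  apply: (trivial_cup1 (B := [pred v | v \notin C]) (g := g) cf cPhi _ h0).
    by move=> u v; exact: gP.
  move=> s sz Ks sC; apply: hP => //.
  by apply: sub_all sC => v /=; rewrite negbK.
move=> y j ji; set x := val y.
have xC : x \in C := valP y.
have [c [_ cP]] := edge_ball_potential x cf nf.
pose side v := if v \in C then None else Some (c v - g v == 1).
have cardY l : (#|edge_ball L y l| <=
    #|[set v in edge_ball K x l | side v == None]|)%N.
  rewrite -(card_imset _ val_inj); apply/subset_leq_card/fintype.subsetP => v.
  case/imsetP => w /edge_ball_induced wl ->; rewrite inE wl /side.
  by have wC : val w \in C := valP w; rewrite wC.
apply: (@leq_trans (#|[set v in edge_ball K x j | side v == None]| +
    2 * \sum_(l < j) #|[set v in edge_ball K x l | side v == None]|)).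
  by apply: leq_add; rewrite // leq_pmul2l //; apply: leq_sum.
apply: (card_edge_ball_sides (i := i) _ ji) => q b qi.
set D := edge_ball K x q.
set N := [set v in D | _]; set S := finset _.
have inN v : (v \in N) = (v \in D) && (v \in C).
  by rewrite inE /side; case: (v \in C).
have notinC' v : (v \notin (C :\: D) :|: S) = ((v \in D) || (v \notin C)) &&
    [|| v \in D, v \notin edge_ball K x q.+1 | side v != Some b].
  rewrite finset.in_setU negb_or finset.in_setD negb_and negbK.
  by rewrite finset.in_set finset.in_setD !negb_and negbK -orbA.
have cutS : cut ((C :\: D) :|: S).
  (* The part cut off by the new set takes the potential of the ball, shifted
     so as to agree with [g] across the side that is not blocked. *)
  pose a : 'Z_2 := if b then 0 else 1.
  pose mov v := (v \in D) && ((v \in C) || (side v == Some b)).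
  apply/asboolP; exists (fun v => if mov v then c v - a else g v).
  have DB v : v \in D -> v \in edge_ball K x i.
    by apply/fintype.subsetP/edge_ball_le/ltnW.
  have DSB u v : u \in D -> adj K u v -> v \in edge_ball K x i.
    move=> uD uv; apply: (fintype.subsetP (edge_ball_le K x qi)).
    exact: edge_ball_adj uD uv.
  have main u v : u \notin C :\: D :|: S -> v \notin C :\: D :|: S ->
      adj K u v -> mov u -> ~~ mov v -> f [:: u; v] = g v - (c u - a).
    rewrite !notinC' => /andP[_ _] /andP[vCD vS] uv.
    rewrite /mov => /andP[uD uCS] nmv.
    have vB := DSB _ _ uD uv.
    have vSq := edge_ball_adj uD uv.
    have vC : v \notin C.
      by case/orP: vCD => // vD; move: nmv; rewrite vD /= negb_or => /andP[].
    have side_v : side v = Some (~~ b).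
      move: vS nmv; rewrite vSq /= (negbTE vC) /=.
      case: (v \in D) => /= [_|/eqP + _]; last move=> nsv.
        by rewrite /side (negbTE vC); case: (_ == 1); case: (b).
      by move: nsv; rewrite /side (negbTE vC); case: (_ == 1); case: (b).
    have uC : u \in C.
      apply: contraT => uC; move: uCS; rewrite (negbTE uC) /= => /eqP su.
      have := cP _ _ (DB _ uD) vB uv; rewrite (gP _ _ uC vC uv) => gc.
      have : c v - g v = c u - g u by rewrite -[c v](subrK (c u)) -gc; ring.
      by move=> e; move: su side_v; rewrite /side (negbTE uC) (negbTE vC) e =>
        -[->] [] /esym; case: (b).
    rewrite (cP _ _ (DB _ uD) vB uv).
    have -> : c v = g v + a.
      have := side_v; rewrite /side (negbTE vC) /a => -[].
      case: (b) => /= [cg1|/eqP <-]; last by rewrite addrC subrK.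
      case: (Z2_cases (c v - g v)) => [/subr0_eq ->|cg]; first by rewrite addr0.
      by rewrite cg eqxx in cg1.
    by ring.
  move=> u v uS vS uv.
  case: (boolP (mov u)) => mu; case: (boolP (mov v)) => mv.
  - rewrite cP ?DB //; first by ring.
    + by case/andP: mu.
    + by case/andP: mv.
  - exact: main.
  - rewrite -[LHS]opprK -(cocycle1_anti cf uv) (main v u) // 1?adjC //.
    by ring.
  - apply: gP => //.
    + by apply: contra mu => uC; move: uS; rewrite /mov notinC' uC !orbF =>
        /andP[-> _].
    + by apply: contra mv => vC; move: vS; rewrite /mov notinC' vC !orbF =>
        /andP[-> _].
have := leq_trans (Cmin _ cutS) (leq_card_setU _ _).
rewrite -(cardsID D C) addnC leq_add2l.
by congr (_ <= _)%N; apply/eq_card => v; rewrite inN inE andbC.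
Qed.

(** * Hypersurfaces of integral cocycles *)

Section IntervalSum.
Implicit Types (F : int -> int) (N L : nat) (a k : int).

(** Stands for a sum over all integers, the summands of interest having bounded
    support. *)
Definition interval_sum N F := \sum_(j < N.*2.+1) F (j%:Z - N%:Z).

Lemma interval_sum_shift1 N F :
  interval_sum N (fun k => F (k + 1)) + F (- N%:Z) =
  interval_sum N F + F (N%:Z + 1).
Proof.
rewrite /interval_sum big_ord_recr [in RHS]big_ord_recl /= sub0r addrAC.
rewrite [F (- N%:Z) + _]addrC; congr (_ + _ + _); last by congr F; lia.
by apply: eq_bigr => j _; congr F; rewrite /bump; lia.
Qed.

Lemma interval_sum_shift N L F a :
    (forall k, (L < `|k|)%N -> F k = 0) -> (L + `|a| < N)%N ->
  interval_sum N (fun k => F (k + a)) = interval_sum N F.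
Proof.
move=> F0; case: (intP a) => [|n|n] bnd.
- by apply: eq_bigr => j _; rewrite addr0.
- elim: n bnd => [|n IH] bnd.
    by have := interval_sum_shift1 N F; rewrite !F0 ?addr0 //; lia.
  rewrite -IH; last by lia.
  have := interval_sum_shift1 N (fun k => F (k + n.+1%:Z)).
  rewrite !F0 ?addr0; [move=> <-|lia|lia].
  by apply: eq_bigr => j _; congr F; lia.
- elim: n bnd => [|n IH] bnd.
    have := interval_sum_shift1 N (fun k => F (k - 1)).
    rewrite !F0 ?addr0; [move=> <-|lia|lia].
    by apply: eq_bigr => j _; congr F; lia.
  rewrite -IH; last by lia.
  have := interval_sum_shift1 N (fun k => F (k - n.+2%:Z)).
  rewrite !F0 ?addr0; [move=> <-|lia|lia].
  by apply: eq_bigr => j _; congr F; lia.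
Qed.

Definition heaviside k : int := (0 <= k)%R%:R.

(** The value of an integral cocycle on an edge is the number, counted with
    sign, of lifts of the edge to the cyclic cover that cross height 0. *)
Lemma interval_sum_heaviside N a : (`|a| < N)%N ->
  interval_sum N (fun k => heaviside (k + a) - heaviside k) = a.
Proof.
have sumB F G : interval_sum N (fun k => F k - G k) =
    interval_sum N F - interval_sum N G by rewrite -sumrB.
move=> aN; rewrite sumB; case: (intP a) aN => [|n|n] bnd.
- apply/eqP; rewrite subr_eq0; apply/eqP.
  by apply: eq_bigr => j _; rewrite addr0.
- apply/eqP; rewrite subr_eq; apply/eqP.
  elim: n bnd => [|n IH] bnd.
    have := interval_sum_shift1 N heaviside; rewrite /heaviside.
    by move: (interval_sum _ _) (interval_sum _ _) => x y; lia.
  have := interval_sum_shift1 N (fun k => heaviside (k + n.+1%:Z)).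
  rewrite IH; last by lia.
  rewrite [in X in X + _ = _](_ : interval_sum N _ =
    interval_sum N (fun k => heaviside (k + n.+2%:Z))).
    rewrite /heaviside.
    by move: (interval_sum _ _) (interval_sum _ _) => x y; lia.
  by apply: eq_bigr => j _; congr heaviside; lia.
- apply/eqP; rewrite subr_eq; apply/eqP.
  elim: n bnd => [|n IH] bnd.
    have := interval_sum_shift1 N (fun k => heaviside (k - 1)).
    rewrite [in X in X + _ = _](_ : interval_sum N _ =
      interval_sum N heaviside).
      rewrite /heaviside.
      by move: (interval_sum _ _) (interval_sum _ _) => x y; lia.
    by apply: eq_bigr => j _; congr heaviside; lia.
  have := interval_sum_shift1 N (fun k => heaviside (k - n.+2%:Z)).
  rewrite [in X in X + _ = _](_ : interval_sum N _ =
    interval_sum N (fun k => heaviside (k - n.+1%:Z))).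
    rewrite IH; last by lia.
    rewrite /heaviside.
    by move: (interval_sum _ _) (interval_sum _ _) => x y; lia.
  by apply: eq_bigr => j _; congr heaviside; lia.
Qed.

End IntervalSum.

Section CyclicCover.
Context (T : finType) (K : vcomplex T) (f : cochain T int).
Hypothesis cf : cocycle1 K f.

(** The infinite cyclic cover defined by [f]: the second component is a height,
    and [f] lifts to its coboundary. *)
Definition cover_vsimplex (s : seq (T * int)) := K (map fst s) /\
  forall a b, a \in s -> b \in s -> b.2 = a.2 + f [:: a.1; b.1].

Lemma cover_vsimplexS s t :
  {subset t <= s} -> cover_vsimplex s -> cover_vsimplex t.
Proof.
move=> ts [Ks sh]; split; last by move=> a b /ts at_ /ts; apply: sh.
apply: vsimplexS Ks => v /mapP[a /ts sa ->].
by apply/mapP; exists a.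
Qed.

Lemma cover_vsimplex1 a : cover_vsimplex [:: a].
Proof.
split; first exact: vsimplex1.
move=> b c; rewrite !inE => /eqP -> /eqP ->.
by rewrite (cocycle1_diag _ cf) addr0.
Qed.

Definition cyclic_cover := VComplex cover_vsimplexS cover_vsimplex1.

Definition lift k (s : seq T) : seq (T * int) :=
  if s is x :: _ then map (fun v => (v, k + f [:: x; v])) s else [::].

Lemma map_fst_lift k s : map fst (lift k s) = s.
Proof. by case: s => // x s; rewrite -map_comp map_id. Qed.

Lemma lift_vsimplex k s : K s -> cyclic_cover (lift k s).
Proof.
move=> Ks; split; first by rewrite map_fst_lift.
case: s Ks => // x s Ks a b /mapP[u us ->] /mapP[v vs ->] /=.
by rewrite -addrA (cocycle1_adj cf Ks) ?mem_head.
Qed.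

Lemma lift_cons k x y r : K (x :: y :: r) ->
  lift k (x :: y :: r) = (x, k) :: lift (k + f [:: x; y]) (y :: r).
Proof.
move=> Ks; rewrite /= !(cocycle1_diag _ cf) !addr0; congr [:: _, _ & _].
apply/eq_in_map => v vr; rewrite -addrA (cocycle1_adj cf Ks) //.
all: by rewrite !inE ?eqxx ?vr ?orbT.
Qed.

Definition cocycle_bound := \max_(u : T) \max_(v : T) `|f [:: u; v]|%N.

Lemma cocycle_boundP u v : (`|f [:: u; v]| <= cocycle_bound)%N.
Proof.
apply: leq_trans (leq_bigmax u).
exact: (leq_bigmax_cond (F := fun v => `|f [:: u; v]|%N)).
Qed.

(** Summation over the lifts of a simplex commutes with coboundaries, for
    cochains supported at bounded heights: deleting the head of a lift changes
    the height of the head by the value of [f], which only permutes the lifts.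
    The product of [f] with [Phi] is such a sum, namely of the jumps of the
    Heaviside function of the height. *)
Lemma transfer_coboundary p Phi L (C : cochain (T * int)%type int) :
    C [::] = 0 ->
    (forall x s, cyclic_cover (x :: s) -> (L < `|x.2|)%N -> C (x :: s) = 0) ->
    (forall x y r, size r = p -> cyclic_cover (x :: y :: r) ->
       coboundary C (x :: y :: r) =
       (heaviside y.2 - heaviside x.2) * Phi (map fst (y :: r))) ->
  trivial_cochain K p.+1 (cup 1 f Phi).
Proof.
move=> C0 CL dC; pose N := (L + cocycle_bound).+1.
exists (fun s => interval_sum N (fun k => C (lift k s))); split.
  by rewrite /interval_sum big1.
case=> [|x [|y r]] // [sr] Ks; rewrite cup1E coboundary_sum.
have Kyr : K (y :: r) by apply: vsimplexS Ks => v vr; rewrite inE vr orbT.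
set F := fun k => coboundary (fun t => C (lift k (x :: t))) (y :: r).
transitivity (interval_sum N (fun k => C (lift k (y :: r))) - interval_sum N F);
  last by rewrite -sumrB; apply: eq_bigr => j _; rewrite coboundary_cons.
rewrite -(interval_sum_shift (L := L) (a := f [:: x; y])); last first.
- by rewrite /N ltnS leq_add2l cocycle_boundP.
- by move=> k Lk; apply: CL; [exact: (lift_vsimplex k Kyr)|rewrite /=
    (cocycle1_diag _ cf) addr0].
rewrite -sumrB.
transitivity (interval_sum N (fun k =>
    (heaviside (k + f [:: x; y]) - heaviside k)) * Phi (y :: r)).
  rewrite interval_sum_heaviside //.
  by rewrite /N ltnS; apply: leq_trans (cocycle_boundP _ _) (leq_addl _ _).
rewrite mulr_suml; apply: eq_bigr => j _; set k : int := (j : nat)%:Z - N%:Z.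
have := lift_vsimplex k Ks; rewrite lift_cons // => Ls.
have -> : heaviside k = heaviside (x, k).2 by [].
have -> : F k = coboundary (fun t => C ((x, k) :: t))
    (lift (k + f [:: x; y]) (y :: r)).
  have lE : lift (k + f [:: x; y]) (y :: r) =
      map (fun v => (v, k + f [:: x; v])) (y :: r).
    exact: esym (congr1 behead (lift_cons k Ks)).
  rewrite lE coboundary_map; apply: eq_coboundary => t _ _.
  by rewrite /= (cocycle1_diag _ cf) addr0.
rewrite -coboundary_cons.
have := dC (x, k) (y, k + f [:: x; y] + f [:: y; y])
  (behead (lift (k + f [:: x; y]) (y :: r))).
rewrite /= size_map sr => /(_ erefl Ls) ->.
by rewrite -map_comp map_id (cocycle1_diag _ cf) addr0.
Qed.

(** If [Phi] is a coboundary on the frontier [Y] of a region [Om] that contains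
    all large heights and no very negative one, then its product with [f] is a
    coboundary. The indicator [chi] of [Om] differs from the Heaviside function
    of the height by a function of bounded support, which gives the term [C1].
    The product of the coboundary of [chi] with [Phi - coboundary h] has the
    primitive [C2], supported on the simplices that meet both [Om] and its
    complement: their faces inside [Om] lie in [Y], where [Phi - coboundary h]
    vanishes. The remaining product, with [coboundary h], is treated by the
    Leibniz rule. *)
Lemma trivial_cup1_cyclic_cover p Phi (Om Y : pred (T * int)) M h :
    closed_cochain K p Phi ->
    (forall v k, (M < `|k|)%N -> Om (v, k) = (0 <= k)) ->
    (forall a b, Om a -> ~~ Om b -> adj cyclic_cover a b -> Y a) ->
    h [::] = 0 ->
    (forall s, size s = p.+1 -> cyclic_cover s -> all Y s ->
       Phi (map fst s) = coboundary h s) ->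
  trivial_cochain K p.+1 (cup 1 f Phi).
Proof.
move=> cPhi OmM OmY h0 Phih.
pose chi a : int := (Om a)%:R.
pose Phit : cochain (T * int)%type int := fun s => Phi (map fst s).
pose Phi' : cochain (T * int)%type int := fun s => Phit s - coboundary h s.
pose dchi : cochain (T * int)%type int :=
  fun s => if s is [:: a; b] then chi b - chi a else 0.
pose mixed (s : seq (T * int)) := has Om s && has (predC Om) s.
pose C1 : cochain (T * int)%type int := fun s =>
  if s is a :: _ then (heaviside a.2 - chi a) * Phit s else 0.
pose C2 : cochain (T * int)%type int := fun s =>
  if s is a :: _ then if mixed s then chi a * Phi' s else 0 else 0.
apply: (@transfer_coboundary p Phi (M + cocycle_bound)
  (fun s => C1 s + C2 s - cup 1 dchi h s)).
- by rewrite /cup /= !mul0r subrr.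
- move=> a s Ks aL.
  have bnd b : b \in a :: s -> Om b = (0 <= a.2).
    move=> bs; have := Ks.2 a b (mem_head _ _) bs.
    have := cocycle_boundP a.1 b.1; rewrite [b]surjective_pairing /=.
    move: (f _) (a.2 : int) aL => z w wL zb ->.
    by rewrite OmM; [apply/idP/idP|]; lia.
  rewrite /C1 /C2 /mixed /chi (bnd a (mem_head _ _)).
  rewrite /heaviside subrr mul0r add0r.
  have -> : has Om (a :: s) && has (predC Om) (a :: s) = false.
    apply/negP => /andP[/hasP[b /bnd ->] pos /hasP[c /bnd cneg]].
    by rewrite /= cneg pos.
  case: s Ks aL bnd => [|b s] Ks aL bnd; first by rewrite /cup /= h0 mulr0 subrr.
  rewrite cup1E /dchi /chi !bnd ?mem_head //; first by rewrite subrr mul0r subrr.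
  by rewrite !inE eqxx orbT.
move=> x y r sr Ls; set s := [:: x, y & r].
have ins : {subset y :: r <= s} by move=> b br; rewrite inE br orbT.
have dPhit : coboundary Phit s = 0.
  rewrite -[LHS]coboundary_map cPhi //= ?size_map ?sr //.
  by case: Ls.
rewrite coboundaryB coboundaryD coboundary_mul_head //.
rewrite coboundary_cup1 //; last first.
  by move=> z _; rewrite /dchi; ring.
have -> : coboundary C2 s = (chi y - chi x) * Phi' (y :: r).
  case: (boolP (mixed s)) => [/andP[/hasP[a as_ Oma] /hasP[b bs Omb]]|nmix].
    rewrite -(coboundary_mul_head chi); last first.
      by rewrite coboundaryB coboundaryK subr0.
    apply: eq_coboundary => -[//|c t] tsz tsub.
    rewrite /C2; case: ifPn => // nmix.
    case: (boolP (Om c)) => [Omc|/negbTE nOmc]; last by rewrite /chi nOmc mul0r.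
    have allOm : all Om (c :: t).
      apply: contraT; rewrite -has_predC => nOm.
      by move: nmix; rewrite /mixed nOm andbT /= Omc.
    have -> : Phi' (c :: t) = 0; last by rewrite mulr0.
    apply/eqP; rewrite subr_eq0; apply/eqP/Phih.
    - by rewrite tsz /= sr.
    - exact: vsimplexS tsub Ls.
    apply/allP => e et; apply: (OmY e b) => //; first exact: (allP allOm).
    by apply: (vsimplex_adj Ls) => //; exact: tsub.
  have -> : chi y = chi x.
    rewrite /chi; congr (_%:R); move: nmix; rewrite /mixed /=.
    by case: (Om x); case: (Om y) => //=; rewrite ?orbT.
  rewrite subrr mul0r -[RHS](@coboundary0 _ _ (fun=> 0) s) //.
  apply: eq_coboundary => -[//|c t] tsz tsub; rewrite /C2.
  case: ifPn => // /andP[/hasP[a /tsub as_ Oma] /hasP[b /tsub bs Omb]].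
  by case/negP: nmix; apply/andP; split; apply/hasP; [exists a|exists b].
by rewrite /Phi' /Phit /dchi; ring.
Qed.

End CyclicCover.

(** The hypersurface is a smallest finite set [Y] of vertices of the cyclic cover
    that contains the frontier of a region [Om] as above. Upstairs it has exactly
    two sides, whereas its image in [K] may separate more than two when [f] jumps
    by more than 1 across it. A ball of [K] centred on the image of [y] lifts to
    the cover as the graph of a height function through [y]. Removing from [Om]
    the lifted ball of radius [q], or adding to [Om] the lifted ball of radius
    [q.+1], moves the frontier from the ball of radius [q] to the next sphere, on
    one side or on the other, and minimality bounds these spheres from below. *)
Lemma has_hypersurfaces_int : has_hypersurfaces int.
Proof.
move=> T K i f cf nf.
pose cov := cyclic_cover cf.
pose cut (Y : {fset T * int}) := exists (Om : pred (T * int)) (M : nat),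
  (forall v k, (M < `|k|)%N -> Om (v, k) = (0 <= k)) /\
  forall a b, Om a -> ~~ Om b -> adj cov a b -> a \in Y.
have cut_ex : exists m, `[< exists Y, cut Y /\ #|` Y| = m >].
  (* A lift of an edge that crosses height 0 starts below the bound of [f]. *)
  pose Y := seq_fset tt
    [seq (v, j%:Z) | v <- enum T, j <- iota 0 (cocycle_bound f)].
  exists #|` Y|; apply/asboolP; exists Y; split => //.
  exists [pred a | 0 <= a.2], 0%N; split => // -[v k] [u l] /= k0.
  rewrite -ltNge => l0 /asboolP[_ /(_ (v, k) (u, l) (mem_head _ _))].
  rewrite !inE eqxx orbT => /(_ isT) /= lk.
  rewrite seq_fsetE; apply/allpairsP; exists (v, `|k|%N) => /=.
  rewrite mem_enum mem_iota; split => //; last by rewrite gez0_abs.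
  have := cocycle_boundP f v u; move: (f _) lk => z; lia.
have [m /asboolP[Y [[Om [M [OmM OmY]]] <-]] Ymin] := ex_minnP cut_ex.
have {m cut_ex}Ymin Z : cut Z -> (#|` Y| <= #|` Z|)%N.
  by move=> cutZ; apply/Ymin/asboolP; exists Z.
pose emb (y : Y) := val y.
pose L := induced_complex cov emb.
exists Y, L, (fun y => (emb y).1); split.
- by move=> s [] /=; rewrite -map_comp.
- move=> p Phi cPhi triv.
  have [||h [h0 hP]] := trivial_induced (K := cov) (L := L) (P := mem Y)
    (p := p) (Phi := fun s => Phi (map fst s)) (fun s => id) val_inj.
  + by move=> a aY; exists [` aY]%fset.
  + have [h [h0 hP]] := triv; exists h; split => // s sz Ls.
    by rewrite -hP // /pullback -map_comp.
  + exact: (trivial_cup1_cyclic_cover cPhi OmM OmY h0 hP).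
move=> y j ji; set x := (emb y).1.
have [c [cx cP]] := edge_ball_potential x cf nf.
pose height v := (emb y).2 + c v.
pose graph v : T * int := (v, height v).
have graph_inj : injective graph by move=> u v [].
pose onB l (a : T * int) := (a.1 \in edge_ball K x l) && (a.2 == height a.1).
have onBP l a : onB l a -> a = graph a.1.
  by case: a => v k /andP[_ /eqP /= ->].
have onB_adj l a b : (l < i)%N -> onB l a -> adj cov a b -> onB l.+1 b.
  move=> li /andP[al /eqP ah] /asboolP[Kab /(_ a b (mem_head _ _))].
  rewrite !inE eqxx orbT => /(_ isT) bh.
  have Kadj : adj K a.1 b.1 by apply/asboolP.
  have bl := edge_ball_adj al Kadj.
  rewrite /onB bl bh ah (cP a.1 b.1) //.
  - by apply/eqP; rewrite /height; ring.
  - by apply: (fintype.subsetP (edge_ball_le K x (ltnW li))).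
  - exact: (fintype.subsetP (edge_ball_le K x li)).
have onBL l w : (l <= i)%N -> w \in edge_ball L y l -> onB l (emb w).
  elim: l w => [|l IH] w li.
    by rewrite inE => /eqP ->; rewrite /onB inE /height cx addr0 !eqxx.
  rewrite inE => /exists_inP[z /IH zl /asboolP zw].
  by apply: (onB_adj _ (emb z)); rewrite ?zl ?(ltnW li) //; apply/asboolP.
pose side v := if graph v \in Y then None else Some (Om (graph v)).
have cardY l : (l <= i)%N -> (#|edge_ball L y l| <=
    #|[set v in edge_ball K x l | side v == None]|)%N.
  move=> li; rewrite -(card_in_imset (f := fun w => (emb w).1)).
    apply/subset_leq_card/fintype.subsetP => v /imsetP[w /(onBL _ _ li) wl ->].
    have := wl => /andP[wl1 _]; rewrite inE wl1 /side -(onBP _ _ wl) /=.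
    by rewrite (valP w).
  move=> w z /(onBL _ _ li)/onBP wl /(onBL _ _ li)/onBP zl wz.
  by apply: val_inj; rewrite -/(emb w) wl wz -zl.
apply: (@leq_trans (#|[set v in edge_ball K x j | side v == None]| +
    2 * \sum_(l < j) #|[set v in edge_ball K x l | side v == None]|)).
  apply: leq_add; first exact: cardY.
  rewrite leq_pmul2l //; apply: leq_sum => l _; apply: cardY.
  exact: leq_trans (ltnW (ltn_ord l)) ji.
apply: (card_edge_ball_sides (i := i) _ ji) => q b qi.
set D := edge_ball K x q.
set N := [set v in D | _]; set S := finset _.
pose E := [fset graph v | v in D]%fset.
have inE' a : (a \in E) = onB q a.
  apply/imfsetP/idP => /= [[v vD ->]|aq]; first by rewrite /onB /= vD eqxx.
  by exists a.1; [case/andP: aq|exact: onBP aq].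
pose Y' := (Y `\` E `|` [fset graph v | v in S])%fset.
have Y'E a : a \in Y -> ~~ onB q a -> a \in Y'.
  by move=> aY aq; rewrite inE in_fsetD inE' aq aY.
have Y'S a : onB q.+1 a -> ~~ onB q a -> Om a = b -> a \in Y'.
  move=> aq1 naq Oma; case: (boolP (a \in Y)) => [aY|naY]; first exact: Y'E.
  rewrite inE; apply/orP; right; apply/imfsetP; exists a.1 => /=.
    rewrite finset.in_set finset.in_setD /side -(onBP _ _ aq1) (negbTE naY) Oma.
    rewrite eqxx andbT; have /andP[-> ah] := aq1; rewrite andbT.
    by apply: contra naq => aD; rewrite /onB aD.
  exact: onBP aq1.
have cutY' : cut Y'.
  pose M' := maxn M (\max_v `|height v|%N).
  have nE l v k : (M' < `|k|)%N -> onB l (v, k) = false.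
    move=> kM; apply/negP => /andP[_ /eqP /= kh].
    have := leq_bigmax (F := fun v => `|height v|%N) v.
    by rewrite -kh; move: kM; rewrite gtn_max; lia.
  have OmM' v k : (M' < `|k|)%N -> Om (v, k) = (0 <= k).
    by rewrite gtn_max => /andP[? _]; apply: OmM.
  case: (boolP b) => [bT|/negbTE bF].
    exists (fun a => Om a && ~~ onB q a), M'; split.
      by move=> v k kM; rewrite nE // andbT OmM'.
    move=> a e /andP[Oma naq]; rewrite negb_and negbK => /orP[nOme ae|eq ae].
      by apply: Y'E => //; exact: OmY Oma nOme ae.
    apply: Y'S; rewrite ?bT //.
    by apply: (onB_adj _ e) => //; rewrite adjC.
  exists (fun a => Om a || onB q.+1 a), M'; split.
    by move=> v k kM; rewrite nE // orbF OmM'.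
  move=> a e Oma; rewrite negb_or => /andP[nOme neq] ae.
  have naq : ~~ onB q a by apply: contra neq => aq; apply: (onB_adj _ a).
  case: (boolP (Om a)) Oma => [Oma _|/negbTE nOma /= aq1].
    by apply: Y'E => //; exact: OmY Oma nOme ae.
  by apply: Y'S; rewrite ?bF.
have card_graph (B : {set T}) : #|` [fset graph v | v in B]%fset| = #|B|.
  by rewrite card_imfset //= cardE.
have := Ymin _ cutY'; rewrite cardfsU => /leq_trans/(_ (leq_subr _ _)).
rewrite card_graph -(cardfsID E Y) addnC leq_add2l => /(leq_trans _); apply.
rewrite -card_graph; apply: fsubset_leq_card; apply/fsubsetP => a.
case/imfsetP => v /=; rewrite finset.in_set => /andP[vD vs] ->.
rewrite in_fsetI inE' /onB vD eqxx !andbT.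
by move: vs; rewrite /side; case: ifP.
Qed.

(** * Cocycles on null-homotopic closed paths *)

Section GridHomotopy.
Context (V : choiceType) (A : comNzRingType) (X : simplicial_complex V).
Context (f : cochain V A).
Hypothesis cf : cocycle X 1 f.

Definition spans (s : seq V) : Prop := X [fset v in s]%fset.

Lemma spans_sub (s t : seq V) : t != [::] -> {subset t <= s} ->
  spans s -> spans t.
Proof.
move=> t0 ts Xs; apply: simplices_sub Xs _ _.
  by apply/fsubsetP => v; rewrite !inE; exact: ts.
case: t t0 {ts} => // v t _; apply/fset0Pn; exists v.
by rewrite !inE eqxx.
Qed.

Lemma cocycle_add s a b c : spans s ->
  a \in s -> b \in s -> c \in s -> f [:: a; b] + f [:: b; c] = f [:: a; c].
Proof.
move=> Xs sa sb sc.
have : coboundary f [:: a; b; c] = 0.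
  apply: cf; split=> //; apply: spans_sub Xs => // v.
  by rewrite !inE => /or3P[] /eqP ->.
rewrite coboundary_cons coboundaryE2 => /eqP; rewrite subr_eq0 => /eqP ->.
by rewrite addrC subrK.
Qed.

Lemma cocycle_diag s a : spans s -> a \in s -> f [:: a; a] = 0.
Proof.
move=> Xs sa; have /eqP := cocycle_add Xs sa sa sa.
by rewrite -subr_eq0 addrK => /eqP.
Qed.

(** Around each grid point the four cells span a simplex, so the sums of [f] along
    two consecutive rows differ by a telescoping sum, which vanishes because the
    rows have the same ends. The last row is constant. *)
Lemma grid_walk_sum0 (cell : nat -> nat -> V) v0 n m :
    spans ([:: v0]) ->
    (forall a b, (a < n)%N -> (b < m)%N ->
       spans ([:: cell a b; cell a.+1 b; cell a b.+1; cell a.+1 b.+1])) ->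
    (forall a, (a <= n)%N -> cell a 0%N = v0) ->
    (forall a, (a <= n)%N -> cell a m = v0) ->
    (forall b, (b <= m)%N -> cell n b = v0) ->
  \sum_(b < m) f [:: cell 0%N b; cell 0%N b.+1] = 0.
Proof.
move=> Xv0 Xcell left right top.
have f00 : f [:: v0; v0] = 0 by apply: cocycle_diag Xv0 _; rewrite mem_head.
suff rows a : (a <= n)%N -> \sum_(b < m) f [:: cell 0%N b; cell 0%N b.+1] =
    \sum_(b < m) f [:: cell a b; cell a b.+1].
  rewrite (rows n) //; apply: big1 => b _.
  by rewrite !top // ltnW.
elim: a => [//|a IH] an; rewrite IH ?(ltnW an) //.
apply/eqP; rewrite -subr_eq0 -sumrB; apply/eqP.
pose h b := f [:: cell a b; cell a.+1 b].
transitivity (\sum_(0 <= b < m) (h b - h b.+1)).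
  rewrite big_mkord; apply: eq_bigr => b _.
  have Xs := Xcell a b an (ltn_ord b).
  have e1 := cocycle_add Xs (a := cell a b) (b := cell a.+1 b) (c := cell a.+1 b.+1).
  have e2 := cocycle_add Xs (a := cell a b) (b := cell a b.+1) (c := cell a.+1 b.+1).
  move: e1 e2; rewrite !inE !eqxx ?orbT => /(_ isT isT isT) e1 /(_ isT isT isT) e2.
  by apply/eqP; rewrite subr_eq addrAC eq_sym subr_eq /h e1 -e2 addrC.
rewrite -[LHS]opprK -sumrN.
under eq_bigr do rewrite opprB.
by rewrite telescope_sumr // /h !left ?right // ?(ltnW an) // f00 subrr oppr0.
Qed.

(** While [c] stays on the [j]-th edge, its partial sum is the sum of [f] along
    the first [j] edges plus the value of [f] on the step from the start of that
    edge to the current vertex; the conditions at both ends of the edge make the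
    passage to the next one cost nothing. *)
Lemma walk_sum_subdivision (c : nat -> V) v0 p n :
    (0 < n)%N ->
    (forall j, (j < size p)%N ->
      spans ([:: nth v0 (v0 :: p) j; nth v0 (v0 :: p) j.+1])) ->
    (forall j b, (j < size p)%N -> (b < n)%N ->
      c (j * n + b)%N \in [:: nth v0 (v0 :: p) j; nth v0 (v0 :: p) j.+1]) ->
    (forall j, (j < size p)%N -> c (j * n)%N = nth v0 (v0 :: p) j) ->
    (forall j, (j < size p)%N -> c (j * n + n.-1)%N = nth v0 (v0 :: p) j.+1) ->
  \sum_(b < (size p * n).-1) f [:: c b; c b.+1] = walk_sum f v0 p.
Proof.
move=> n0 Xp cin cl cr.
set P := nth v0 (v0 :: p) in Xp cin cl cr *.
have f0 j : (j < size p)%N -> f [:: P j; P j] = 0 /\ f [:: P j.+1; P j.+1] = 0.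
  by move=> jp; split; apply: cocycle_diag (Xp j jp) _; rewrite !inE eqxx ?orbT.
have walkS j : (j < size p)%N -> walk_sum f v0 (take j.+1 p) =
    walk_sum f v0 (take j p) + f [:: P j; P j.+1].
  move=> jp; rewrite (take_nth v0) // walk_sum_rcons; congr (_ + f [:: _; _]).
  rewrite /P; case: (j) jp => [|k] kp; first by rewrite take0.
  by rewrite (last_nth v0) size_takel ?(ltnW kp) //= nth_take.
have main j : (j < size p)%N -> forall b, (b < n)%N ->
    \sum_(d < j * n + b) f [:: c d; c d.+1] =
    walk_sum f v0 (take j p) + f [:: P j; c (j * n + b)%N].
  elim: j => [|j IHj] jp.
    elim=> [|b IHb] bn.
      by rewrite big_ord0 take0 (cl 0%N jp) (f0 _ jp).1 addr0.
    rewrite addnS big_ord_recr /= IHb ?(ltnW bn) // -addrA; congr (_ + _).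
    by apply: (cocycle_add (Xp _ jp)); rewrite -?addnS;
      [exact: mem_head|apply: cin; rewrite // ltnW|exact: cin].
  have jp' := ltnW jp.
  elim=> [|b IHb] bn.
    have e : (j.+1 * n + 0 = (j * n + n.-1).+1)%N by rewrite mulSn; lia.
    have ce : c (j.+1 * n + 0)%N = P j.+1 by rewrite addn0 cl.
    rewrite ce (f0 _ jp).1 e big_ord_recr /= IHj ?ltn_predL // -e ce cr //.
    by rewrite (f0 _ jp).1 walkS // !addr0.
  rewrite addnS big_ord_recr /= IHb ?(ltnW bn) // -addrA; congr (_ + _).
  by apply: (cocycle_add (Xp _ jp)); rewrite -?addnS;
      [exact: mem_head|apply: cin; rewrite // ltnW|exact: cin].
case: (posnP (size p)) => [p0|p0].
  by rewrite p0 mul0n big_ord0 (size0nil p0).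
pose j := (size p).-1; have jp : (j < size p)%N by rewrite ltn_predL.
have -> : (size p * n).-1 = (j * n + n.-1)%N.
  by rewrite -[X in (X * n)%N](prednK p0) mulSn -/j -[X in (X + _)%N](prednK n0);
    lia.
rewrite main ?ltn_predL // cr // -walkS //.
by rewrite /j prednK // take_size.
Qed.

End GridHomotopy.

Section Realization.
Context (R : realType) (V : choiceType) (X : simplicial_complex V).
Implicit Types (x : realization R X) (v : V).

Lemma open_star v : open [set x : realization R X | 0 < coords x v].
Proof.
move=> s Xs; exists [set y : prod_topology (fun _ : V => R) | 0 < y v].
split=> //.
have : open ((@proj V (fun _ : V => R) v @^-1` [set t : R | 0 < t])
    : set (prod_topology (fun _ : V => R))).
  apply: open_comp; last exact: open_gt.
  by move=> y _; exact: proj_continuous.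
by [].
Qed.

Lemma realization_carrier x :
  exists2 s, X s & geometric_simplex s (coords x).
Proof. by have [s Xs sx] := set_mem (valP x); exists s. Qed.

Lemma star_spans x (l : seq V) : l != [::] ->
  (forall v, v \in l -> 0 < coords x v) -> spans X l.
Proof.
have [s Xs [_ x0 _]] := realization_carrier x.
move=> l0 lx; apply: (simplices_sub Xs); last first.
  case: l l0 {lx} => // v l _; apply/fset0Pn; exists v.
  by rewrite !inE eqxx.
apply/fsubsetP => v; rewrite !inE /= => /lx; apply: contraTT => /x0 ->.
by rewrite ltxx.
Qed.

Lemma star_cover x : exists v, 0 < coords x v.
Proof.
have [s Xs [xge0 x0 x1]] := realization_carrier x.
apply: contrapT => /forallNP xle0; have := oner_neq0 R; rewrite -x1.
rewrite big1 ?eqxx // => v _; apply/eqP; rewrite eq_le xge0 andbT leNgt.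
exact/negP/xle0.
Qed.

(** The open stars cover the realization, and this is a Lebesgue number for the
    cover of [Q] by their preimages. *)
Lemma lebesgue_star (Q : set (R * R)) (H : R * R -> realization R X) :
    compact Q -> {within Q, continuous H} ->
  exists2 e : R, 0 < e & forall z, Q z -> exists v, forall y, Q y ->
    ball z e y -> 0 < coords (H y) v.
Proof.
move=> cQ /subspace_continuousP cH.
pose P (e : R) z := exists v, forall y, Q y -> ball z e y -> 0 < coords (H y) v.
have : \forall e \near 0^'+, Q `<=` P e.
  apply: (iffLR (compact_near_coveringP Q) cQ) => x Qx.
  have [v xv] := star_cover (H x).
  have /= nbU := cH x Qx _ (open_nbhs_nbhs (conj (open_star v) xv)).
  have /nbhs_ballP[/= d d0 dP] : nbhs x [set y | Q y -> 0 < coords (H y) v] by [].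
  exists (ball x (d / 2), [set e : R | e < d / 2]) => /=.
    split; first by apply: nbhsx_ballx; rewrite divr_gt0.
    by apply: nbhs_right_lt; rewrite divr_gt0.
  move=> [z e] /= [xz ed]; exists v => y Qy zy; apply: (dP y _ Qy).
  rewrite [d]splitr; apply: ball_triangle xz _.
  by apply: le_ball zy; exact: ltW.
move=> /(filterI (nbhs_right_gt 0)) /filter_ex[e [e0 eP]].
by exists e.
Qed.

End Realization.

Section NullHomotopic.
Context (R : realType) (V : choiceType) (A : comNzRingType).
Context (X : simplicial_complex V) (f : cochain V A).
Hypothesis cf : cocycle X 1 f.
Implicit Types (v w : V) (p : seq V).

Lemma closed_edge_path_nth v0 p j : closed_edge_path X v0 p ->
  (j < size p)%N ->
  spans X [:: nth v0 (v0 :: p) j; nth v0 (v0 :: p) j.+1].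
Proof.
move=> [_ pth _] jp; have /(pathP v0)/(_ j jp)/andP[_ /asboolP] := pth.
by rewrite /spans; congr (X _); apply/fsetP => v; rewrite !inE orbF.
Qed.

Lemma edge_path_point_nat (v0 w : V) p j :
  edge_path_point v0 p (j%:R : R) w = vertex_point R (nth v0 (v0 :: p) j) w.
Proof. by rewrite /edge_path_point natrK subrr subr0 mul1r mul0r addr0. Qed.

Lemma edge_path_point_support (v0 : V) p (t : R) w j : Num.truncn t = j ->
    0 < edge_path_point v0 p t w ->
  w \in [:: nth v0 (v0 :: p) j; nth v0 (v0 :: p) j.+1].
Proof.
rewrite /edge_path_point => ->; apply: contraTT.
rewrite !inE negb_or => /andP[w0 w1].
by rewrite /vertex_point (negbTE w0) (negbTE w1) !mulr0 addr0 ltxx.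
Qed.

Lemma vertex_point_gt0 v w : 0 < vertex_point R v w -> w = v.
Proof. by rewrite /vertex_point ltr0n lt0b => /eqP. Qed.

(** Simplicial approximation of the homotopy, cell by cell: each cell of a fine
    grid is sent into the open star of a vertex. The cells around a grid point
    have stars with a common point, so their vertices span a simplex. On the
    three constant sides of the square the vertex can only be [v0], and on the
    fourth one it follows the path. *)
Lemma null_homotopic_walk_sum v0 p : closed_edge_path X v0 p ->
  null_homotopic R X v0 p -> walk_sum f v0 p = 0.
Proof.
move=> cp [H [cH H0 H1 Hs]].
have [->|p0] := eqVneq p [::]; first by [].
have {}p0 : (0 < size p)%N by case: (p) p0.
set m := size p in H0 H1 Hs cH p0 *.
have [e e0 eP] := lebesgue_star (compact_setX
  (@segment_compact R 0 1) (@segment_compact R 0 m%:R)) cH.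
(* Cells of side 1 / n are small enough, and integral times are grid points. *)
pose n := (Num.truncn e^-1).+1.
have n0 : (0 : R) < n%:R by rewrite ltr0n.
have ne : n%:R^-1 < e.
  by rewrite invf_plt ?posrE // truncnS_gt.
pose G a b : R * R := (a%:R / n%:R, b%:R / n%:R).
have inI a k : (a <= k * n)%N -> a%:R / n%:R \in `[(0 : R), k%:R].
  move=> ak; rewrite in_itv /= divr_ge0 ?ler0n //=.
  by rewrite ler_pdivrMr // -natrM ler_nat.
have inQ a b : (a <= n)%N -> (b <= m * n)%N ->
    (`[0, 1] `*` `[0, m%:R])%classic (G a b).
  by move=> an bm; split => /=; [apply: (inI a 1%N); rewrite mul1n|exact: inI].
have close a a' : (a <= a' <= a.+1)%N -> `|a%:R / n%:R - a'%:R / n%:R : R| < e.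
  move=> aa'; apply: le_lt_trans ne; rewrite -mulrBl normrM.
  rewrite [X in _ * X]ger0_norm ?invr_ge0 ?ler0n // ler_piMl ?invr_ge0 ?ler0n //.
  rewrite distrC -natrB; last by case/andP: aa'.
  by rewrite normr_nat lern1; lia.
have /choice[cell0 cell0P] : forall ab : nat * nat, exists v,
    (ab.1 < n)%N -> (ab.2 < m * n)%N ->
    forall a b, (ab.1 <= a <= ab.1.+1)%N -> (ab.2 <= b <= ab.2.+1)%N ->
    0 < coords (H (G a b)) v.
  move=> [a b] /=.
  case: (ltnP a n) => [an|]; last by exists v0.
  case: (ltnP b (m * n)) => [bm|]; last by exists v0.
  have [v vP] := eP (G a b) (inQ a b (ltnW an) (ltnW bm)).
  exists v => _ _ a' b' aa' bb'; apply: vP.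
    by apply: inQ; lia.
  by split; apply: close.
pose cell a b := cell0 (a, b).
have cellP a b a' b' : (a < n)%N -> (b < m * n)%N ->
    (a <= a' <= a.+1)%N -> (b <= b' <= b.+1)%N ->
    0 < coords (H (G a' b')) (cell a b).
  by move=> an bm aa' bb'; exact: cell0P.
have mn0 : (0 < m * n)%N by rewrite muln_gt0 p0.
have G0 b : G 0%N b = (0, b%:R / n%:R) by rewrite /G mul0r.
have Gl a : G a 0%N = (a%:R / n%:R, 0) by rewrite /G mul0r.
have Gr a : G a (m * n)%N = (a%:R / n%:R, m%:R).
  by rewrite /G natrM mulfK // gt_eqF.
have Gt b : G n b = (1, b%:R / n%:R) by rewrite /G divff // gt_eqF.
have row0 b w : (b <= m * n)%N -> 0 < coords (H (G 0%N b)) w ->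
    0 < edge_path_point v0 p (b%:R / n%:R : R) w.
  by move=> bm; rewrite G0 H0 //; exact: inI.
have row0_nat j w : (j <= m)%N -> 0 < coords (H (G 0%N (j * n)%N)) w ->
    w = nth v0 (v0 :: p) j.
  move=> jm /row0; rewrite leq_mul2r jm orbT => /(_ isT).
  rewrite natrM mulfK ?gt_eqF // edge_path_point_nat.
  exact: vertex_point_gt0.
have Xv0 : spans X [:: v0].
  have := closed_edge_path_nth cp p0; apply: spans_sub => // v.
  by rewrite !inE => ->.
rewrite -(walk_sum_subdivision cf (c := cell 0%N) (n := n)) //.
- rewrite -/m; apply: (grid_walk_sum0 cf (n := n.-1) Xv0).
  + move=> a b an bm; apply: (@star_spans _ _ _ (H (G a.+1 b.+1))) => // v.
    by rewrite !inE => /or4P[] /eqP ->; apply: cellP; lia.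
  + move=> a an; have /Hs[hl _] : (a%:R / n%:R : R) \in `[0, 1].
      by apply: (inI a 1%N); lia.
    apply/vertex_point_gt0; rewrite -hl -Gl; apply: cellP; lia.
  + move=> a an; have /Hs[_ hr] : (a%:R / n%:R : R) \in `[0, 1].
      by apply: (inI a 1%N); lia.
    apply/vertex_point_gt0; rewrite -hr -Gr; apply: cellP; lia.
  + move=> b bm; apply/vertex_point_gt0; rewrite -(H1 (b%:R / n%:R)).
      by rewrite -Gt; apply: cellP; lia.
    by apply: inI; lia.
- by move=> j; exact: closed_edge_path_nth.
- move=> j b jm bn; apply: (edge_path_point_support
    (t := ((j * n + b)%:R / n%:R : R))).
    apply: truncn_def; rewrite ler_pdivlMr // ltr_pdivrMr // -!natrM ler_nat ltr_nat.
    by rewrite mulSn; lia.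
  have jbm : (j * n + b < m * n)%N.
    by apply: leq_trans (leq_mul jm (leqnn n)); rewrite mulSn; lia.
  by apply: row0; [exact: ltnW|apply: cellP; lia].
- move=> j jm; apply: row0_nat; first exact: ltnW.
  by apply: cellP; rewrite ?leqnn ?leqnSn ?ltn_mul2r ?jm.
- move=> j jm; apply: row0_nat; first by [].
  apply: cellP => //; first last.
  - by rewrite mulSn; lia.
  - by apply: leq_trans (leq_mul jm (leqnn n)); rewrite mulSn; lia.
Qed.

End NullHomotopic.

(** * From the simplicial complex to its vertices *)

Section Transfer.
Context (R : realType) (V : choiceType) (X : simplicial_complex V).
Context (A : comNzRingType).

Definition spans_or_nil (s : seq V) : Prop := s = [::] \/ spans X s.

Lemma spans1 v : spans X [:: v] = vertices X v.
Proof.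
rewrite /spans /vertices /=; congr (X _).
by apply/fsetP => w; rewrite !inE ?orbF.
Qed.

Lemma walk_without_pauses (f : cochain V A) x p : cocycle X 1 f ->
    path (adj spans_or_nil) x p ->
  exists q, [/\ path (edge X) x q, last x q = last x p, (size q <= size p)%N
    & walk_sum f x q = walk_sum f x p].
Proof.
move=> cf; elim: p x => [|y p IH] x /=; first by exists [::].
case/andP=> /asboolP[//|Xxy] /IH[q [yq lq sq wq]].
case: (eqVneq x y) => [xy|xy].
  exists q; rewrite xy; split; rewrite ?(leqW sq) //.
  rewrite wq (_ : f [:: y; y] = 0) ?add0r //.
  by apply: (cocycle_diag cf Xxy); rewrite !inE eqxx orbT.
exists (y :: q); rewrite /= lq wq yq andbT; split => //.
rewrite /edge xy /=; apply/asboolP; move: Xxy; rewrite /spans.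
by congr (X _); apply/fsetP => v; rewrite !inE orbF.
Qed.

(** This includes an infinite systole, when [sys] is 0 and no path is
    shorter. *)
Lemma short_loops_contractible_sys : short_loops_contractible R X (sys R X).
Proof. by rewrite /sys; case: xgetP => [m _ []|_ v0 p _]. Qed.

(** Unless the systole is at most 1, where the bound on the length is 1, it
    exceeds the length of the walk: [2 * (m %/ 2 - 1) + 1 < m] for [m >= 2]. *)
Lemma short_loops_null_sys (f : cochain V A) : cocycle X 1 f ->
  short_loops_null spans_or_nil f (2 * (sys R X %/ 2 - 1) + 1).
Proof.
move=> cf x p xp lp sp.
case: p xp lp sp => [//|y p] xp lp sp.
have [q [xq lq sq <-]] := walk_without_pauses cf xp.
have Xx : vertices X x.
  have /andP[/asboolP[//|Xxy] _] := xp.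
  rewrite -spans1; apply: spans_sub Xxy => // v.
  by rewrite !inE => ->.
have cq : closed_edge_path X x q by split=> //; rewrite lq.
case: (ltnP (size q) (sys R X)) => [qs|sys_q].
  exact: (null_homotopic_walk_sum cf cq (short_loops_contractible_sys cq qs)).
(* The systole is at most 1 here, and no closed path has length 1. *)
have q1 : (size q <= 1)%N by lia.
case: q q1 cq {xq lq sq sys_q} => [|z [|//]] // _ [_ /=].
by rewrite /edge => /andP[/andP[xz _] _] zx; rewrite zx eqxx in xz.
Qed.

Lemma card_vertices_ge n : has_hypersurfaces A -> cup_essential A X n ->
  `I_(\sum_(0 <= k < n.+1) breve_b k (sys R X %/ 2 - 1))%N #<= vertices X.
Proof.
move=> hypA [fs [cfs ess]]; set i := (_ %/ 2 - 1)%N; set N := (\sum_(0 <= _ < _) _)%N.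
have [finX|/infiniteP infX] := pselect (finite_set (vertices X)); last first.
  by apply: card_le_trans infX; exact: subset_card_le.
pose T := fset_set (vertices X).
have TX v : v \in T -> vertices X v by rewrite in_fset_set // => /set_mem.
have KS (s t : seq T) : {subset t <= s} -> spans_or_nil (map val s) ->
    spans_or_nil (map val t).
  move=> ts; case: t ts => [|x t] ts; first by left.
  case=> [s0|Xs]; first by case: s s0 ts => // _ /(_ x (mem_head _ _)).
  right; apply: spans_sub Xs => // _ /mapP[y /ts ys ->].
  by apply/mapP; exists y.
have K1 (x : T) : spans_or_nil (map val [:: x]).
  by right; rewrite /= spans1; apply: TX; exact: valP.
pose K := VComplex KS K1.
have cocT (f : cochain V A) : cocycle X 1 f -> cocycle1 spans_or_nil f.
  move=> cf x y z [//|Xs]; apply: (cocycle_add cf Xs); by rewrite !inE eqxx ?orbT.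
have fsP f : f \in (fs : seq _) -> cocycle X 1 f.
  by case/tnthP => j ->.
have LK s : K s -> spans_or_nil (map val s) by [].
have [|||_ NT] := @essential_ball_card A i n hypA T K
    (map (pullback val) fs).
- by rewrite size_map size_tuple.
- move=> _ /mapP[f /fsP cf ->]; split.
    exact: (pullback_cocycle1 LK (cocT f cf)).
  exact: (pullback_short_loops_null LK (short_loops_null_sys cf)).
- move=> triv; apply: ess.
  have [|||h [h0 hP]] := trivial_induced (K := spans X) (L := K)
    (P := mem T) (p := n) (Phi := cup_seq1 fs) _ val_inj.
  + by move=> s Xs; right.
  + by move=> v vT; exists [` vT]%fset.
  + have [h [h0 hP]] := triv; exists h; split => // s sz Ks.
    by rewrite -hP // cup_seq1_pullback.
  have {}hP s : ordered_simplex X n s -> cup_seq1 fs s = coboundary h s.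
    move=> [sz Xs]; apply: hP => //; apply/allP => v vs.
    rewrite /= in_fset_set //; apply/mem_set; rewrite -spans1.
    by apply: spans_sub Xs => // w; rewrite !inE => /eqP ->.
  move: (cup_seq1 fs) hP => Phi; case: (n) => [|k] hP; last by exists h.
  by move=> s sx; rewrite hP //; case: s sx => [|x [|y s]] [] // _ _;
    rewrite coboundary1.
have [m Xm] := finX.
have Tm : #|` T| = m := card_fset_set Xm.
rewrite (card_le_eqr Xm) card_le_II -Tm cardfE.
exact: NT.
Qed.

End Transfer.

Theorem theorem1p12 (R : realType) (V : choiceType) (X : simplicial_complex V)
    (n : nat) (n_ge1 : (1 <= n)%N)
    (X_essential : cup_essential int X n \/ cup_essential 'Z_2 X n) :
  let i := ((sys R X) %/ 2 - 1)%N in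
  `I_(\sum_(0 <= k < n.+1) breve_b k i)%N #<= vertices X /\
  (2 ^ n * 'C(i, n) <= \sum_(0 <= k < n.+1) breve_b k i)%N.
Proof.
move=> i; split.
  case: X_essential => ess.
    exact: (@card_vertices_ge R V X _ n has_hypersurfaces_int ess).
  exact: (@card_vertices_ge R V X _ n has_hypersurfaces_Z2 ess).
by rewrite big_nat_recr //=; apply: leq_trans (breve_b_ge n i) (leq_addl _ _).
Qed.
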